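(* For all $\delta,t>0$, for every subordinator $X$, $$N(t,\delta)\asymp L(t,\delta).$$ In particular, $L(t,\delta)$ can be used to define the box-counting dimension of the range $\{X_s:0\le s\le t\}$, i.e. $$\lim_{\delta\to0}\frac{\log N(t,\delta)}{\log(1/\delta)}=\lim_{\delta\to0}\frac{\log L(t,\delta)}{\log(1/\delta)}.$$
   Context: A subordinator $X=(X_t)_{t\ge0}$ is a non-decreasing real-valued Lévy process (stationary independent increments, started at $0$). Its law is determined by $\mathbb{E}[e^{-\lambda X_1}]=e^{-\Phi(\lambda)}$, $\lambda\ge0$, with $\Phi(\lambda)=\mathrm{d}\lambda+\int_0^\infty(1-e^{-\lambda x})\,\Pi(dx)$, where $\mathrm{d}$ is the linear drift and $\Pi$ is the Lévy measure, satisfying $\int_0^\infty(1\wedge x)\,\Pi(dx)<\infty$. Write $\overline{\Pi}(x):=\Pi((x,\infty))$. $N(t,\delta)$ is the minimal number of intervals of length at most $\delta$ needed to cover the range $\{X_s:0\le s\le t\}$. The box-counting dimension of the range is $\lim_{\delta\to0}\log N(t,\delta)/\log(1/\delta)$. For $\delta>0$, the process of $\delta$-shortened jumps $\tilde X^\delta=(\tilde X^\delta_t)_{t\ge0}$ is obtained from $X$ by shortening all jumps of size larger than $\delta$ to instead have size $\delta$. That is, $\tilde X^\delta$ is the subordinator with drift $\mathrm{d}$ and Lévy measure $\tilde\Pi^\delta(dx)=\Pi(dx)\mathbf{1}_{\{x<\delta\}}+\overline{\Pi}(\delta)\Delta_\delta(dx)$, where $\Delta_\delta$ is a unit point mass at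 $\delta$. Define $L(t,\delta):=\frac1\delta\tilde X^\delta_t$. The notation $f\asymp g$ means that there exist positive constants $A,B$ such that $A f(x)\le g(x)\le B f(x)$ for all $x$.
   Formalization: The bound A·N(t,δ) ≤ L(t,δ) is stated only for δ < X_t, since for δ ≥ X_t one has N = 1 and L = X_t/δ, which can be arbitrarily small or 0; L ≤ B·N holds for all t, δ > 0. Where X_t = 0, the limit claim takes log 0 = 0. *)

(* Defs.v *)
From HB Require Import structures.
From mathcomp Require Import all_boot all_order all_algebra.
From mathcomp Require Import all_classical all_reals all_analysis.

Set Implicit Arguments.
Unset Strict Implicit.
Unset Printing Implicit Defensive.

Import Order.TTheory GRing.Theory Num.Theory.
Import numFieldNormedType.Exports.

Local Open Scope classical_set_scope.
Local Open Scope ring_scope.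

(* Processes are indexed by the whole of R; only the times t >= 0 are ever
   constrained or used. *)

Section subordinator.
Context {R : realType} {d : measure_display} {T : measurableType d}.
Variables (P : probability T R) (X : R -> {RV P >-> R}).

(* Since some of the A i may be the full set, the product rule over all
   increments gives mutual independence (the rule for every subfamily). *)
Definition independent_increments : Prop :=
  forall (n : nat) (t : nat -> R) (A : nat -> set R),
    0 <= t 0%N -> (forall i, t i <= t i.+1) -> (forall i, measurable (A i)) ->
    P [set w | forall i, (i < n)%N -> A i (X (t i.+1) w - X (t i) w)] =
    (\prod_(i < n) P [set w | A i (X (t i.+1) w - X (t i) w)%R])%E.

Definition stationary_increments : Prop :=
  forall (s h : R) (A : set R), 0 <= s -> 0 <= h -> measurable A ->
    P [set w | A (X (s + h) w - X s w)] = P [set w | A (X h w)].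

(* Left limits need not be required: monotone paths have them. *)
Definition subordinator : Prop :=
  [/\ {ae P, forall w, X 0 w = 0},
      {ae P, forall w (s t : R), 0 <= s -> s <= t -> X s w <= X t w},
      {ae P, forall w (s : R), 0 <= s -> X u w @[u --> s^'+] --> X s w},
      independent_increments & stationary_increments].

End subordinator.

Section paths.
Context {R : realType}.
Implicit Types (f : R -> R) (E : set R) (t delta : R).

Definition path_range f t : set R := [set f s | s in `[0, t]].

Definition covered_by E delta (n : nat) : Prop :=
  exists I : 'I_n -> interval R,
    (forall i, (lebesgue_measure [set` I i] <= delta%:E)%E) /\
    E `<=` \bigcup_i [set` I i].

(* The junk value 0 is taken only when no finite cover exists, which does not
   happen for bounded E and delta > 0. *)
Definition covering_number E delta : nat :=
  get [set n | covered_by E delta n /\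
               forall m, covered_by E delta m -> (n <= m)%N].

Definition jump f (s : R) : R := f s - lim (f u @[u --> s^'-]).

(* The excess max(0, jump - delta) of every jump up to time t is removed from
   f t. For a non-decreasing right-continuous f only finitely many terms of the
   sum are nonzero. *)
Definition shortened f delta t : R :=
  f t - \sum_(s \in `]0, t]) Num.max 0 (jump f s - delta).

Definition boxN f t delta : R := (covering_number (path_range f t) delta)%:R.

Definition boxL f t delta : R := delta^-1 * shortened f delta t.

End paths.

(* Main.v *)
(* The statement is pathwise. Let f be a non-decreasing right-continuous path
   with f 0 = 0 and let g be f with the excess over delta of every jump removed.
   An increment f t - f s that contains a jump larger than delta loses, for each
   such jump, its size minus delta; as the jumps sum to at most f t - f s, what
   remains is at least delta. Hence
     min (f t - f s, delta) <= g t - g s <= f t - f s.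
   The lower bound shows that the times at which g lies in a given window
   [k delta, (k + 1) delta[ are mapped by f into an interval of length delta, so
   that N <= L + 1, and L >= 1 as soon as delta < f t. Conversely, g has no jump
   larger than delta, so every y in [0, g t] is within 2 delta above a value
   of g; by the upper bound, an interval of length delta of the cover then
   accounts for a subset of [0, g t] of diameter at most 4 delta, so that
   L <= 4 N. *)
Require Import Defs.
From HB Require Import structures.
From mathcomp Require Import all_boot all_order all_algebra.
From mathcomp Require Import all_classical all_reals all_analysis.
From mathcomp Require Import finmap lra.

Import Order.TTheory GRing.Theory Num.Theory.
Import numFieldNormedType.Exports.

Local Open Scope classical_set_scope.
Local Open Scope ring_scope.

(** * Intervals and covering numbers *)

Lemma itv_diam_le (R : realType) (I : interval R) (d x y : R) :
  (lebesgue_measure [set` I] <= d%:E)%E ->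
  [set` I] x -> [set` I] y -> y - x <= d.
Proof.
move=> mI Ix Iy; have [xy|yx] := ltP x y; last first.
  apply: (@le_trans _ _ 0); first by rewrite subr_le0.
  by rewrite -lee_fin (le_trans _ mI).
rewrite -lee_fin; apply: le_trans mI.
have <- : lebesgue_measure `[x, y]%classic = (y - x)%:E.
  by rewrite lebesgue_measure_itv/= lte_fin xy EFinB.
apply: le_measure; [by apply/mem_set; exact: measurable_itv..|].
move=> z /=; rewrite in_itv/=.
exact: (@interval_is_interval _ I x y Ix Iy).
Qed.

(* Unqualified, covered_by would be the classical_sets notion. *)
Lemma covering_numberP (R : realType) (E : set R) (d : R) (n : nat) :
  Defs.covered_by E d n ->
  Defs.covered_by E d (covering_number E d) /\ (covering_number E d <= n)%N.
Proof.
move=> En; have En' : exists k, `[< Defs.covered_by E d k >].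
  by exists n; apply/asboolP.
have [m /asboolP Em mmin] := ex_minnP En'.
have [] : [set k | Defs.covered_by E d k /\
    forall m, Defs.covered_by E d m -> (k <= m)%N] (covering_number E d).
  by apply: getPex; exists m; split => // k Ek; apply/mmin/asboolP.
by move=> cE min; split => //; exact: min.
Qed.

(** * Left limits and jumps of a monotone path *)

Section nondecreasing_path.
Context {R : realType}.
Variable f : R -> R.
Hypothesis f_nd : forall s t : R, 0 <= s -> s <= t -> f s <= f t.

Local Notation left_lim s := (lim (f u @[u --> s^'-])).

Lemma left_lim_cvg (s : R) : 0 < s -> cvg (f u @[u --> s^'-]).
Proof.
move=> s0; apply: nondecreasing_at_left_is_cvgr;
    apply: filterS (nbhs_left_gt s0) => x x0.
  move=> u v; rewrite !in_itv/= => /andP[xu us] _; apply: f_nd.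
  exact/ltW/(lt_trans x0 xu).
exists (f s) => y [u /=]; rewrite in_itv/= => /andP[xu us] <-.
by apply: f_nd; [exact/ltW/(lt_trans x0 xu)|exact: ltW].
Qed.

Lemma left_lim_ge (u s : R) : 0 <= u -> u < s -> f u <= left_lim s.
Proof.
move=> u0 us; apply: limr_ge; first exact/left_lim_cvg/(le_lt_trans u0).
by near=> v; apply: f_nd => //; near: v; apply: filterS (nbhs_left_gt us) => ? /ltW.
Unshelve. all: by end_near. Qed.

Lemma jump_le (u s : R) : 0 <= u -> u < s -> jump f s <= f s - f u.
Proof. by move=> u0 us; rewrite lerB// left_lim_ge. Qed.

Lemma jump_approx (s a e : R) : 0 <= a -> a < s -> 0 < e ->
  exists u, [/\ a < u, u < s & f s - f u <= jump f s + e].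
Proof.
move=> a0 as_ e0.
have /cvgrPdist_le/(_ _ e0) fs := left_lim_cvg _ (le_lt_trans a0 as_).
near (s^'-) => u; exists u; split.
- by near: u; exact: nbhs_left_gt.
- by near: u; exact: nbhs_left_lt.
- have : `|left_lim s - f u| <= e by near: u.
  by rewrite /jump => /(le_trans (ler_norm _)); lra.
Unshelve. all: by end_near. Qed.

(** Telescoping: the jump at each point of [r] is at most the increment of [f] from the preceding
    point. *)
Lemma sum_jump_le_sorted (s t : R) (r : seq R) : 0 <= s -> s <= t ->
  path <%R s r -> all (fun u => u <= t) r ->
  \sum_(u <- r) jump f u <= f t - f s.
Proof.
elim: r s => [|x r IH] s s0 st /=.
  by rewrite big_nil subr_ge0 f_nd.
move=> /andP[sx xr] /andP[xt rt]; rewrite big_cons.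
have := IH x (ltW (le_lt_trans s0 sx)) xt xr rt.
by have := jump_le s x s0 sx; lra.
Qed.

Lemma sum_jump_le (s t : R) (r : seq R) : 0 <= s -> s <= t -> uniq r ->
  {in r, forall u, s < u <= t} -> \sum_(u <- r) jump f u <= f t - f s.
Proof.
move=> s0 st ur rst; rewrite -(perm_big _ (permEl (perm_sort <=%R r)))/=.
apply: sum_jump_le_sorted => //; last first.
  by apply/allP => u; rewrite mem_sort => /rst /andP[].
rewrite lt_path_sortedE lt_sorted_uniq_le sort_uniq ur sort_le_sorted !andbT.
by apply/allP => u; rewrite mem_sort => /rst /andP[].
Qed.

(** * Increments of the path with shortened jumps *)

Section truncation.
Variables (delta T : R).
Hypotheses (delta0 : 0 < delta) (T0 : 0 <= T).

Definition big_jumps := `]0, T] `&` [set s | delta < jump f s].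

(** More than [(f T - f 0) / delta] jumps above [delta] would sum to more than [f T - f 0]. *)
Lemma finite_big_jumps : finite_set big_jumps.
Proof.
apply: contrapT => /(@infinite_set_fset _ _
  (Num.truncn ((f T - f 0) / delta)).+1) [B BJ cB].
have BE u : u \in enum_fset B -> (0 < u <= T) && (delta < jump f u).
  by move=> /BJ[]/=; rewrite in_itv/= => -> ->.
have := sum_jump_le 0 T (enum_fset B) (lexx 0) T0 (fset_uniq B).
move=> /(_ (fun u uB => proj1 (andP (BE u uB)))).
rewrite leNgt => /negP; apply.
apply: lt_le_trans (_ : delta * #|` B|%:R <= _).
  rewrite mulrC -ltr_pdivrMr//; apply: lt_le_trans (truncnS_gt _) _.
  by rewrite ler_nat.
have -> : delta * #|` B|%:R = \sum_(u <- enum_fset B) delta.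
  by rewrite big_const_seq count_predT iter_addr_0 mulr_natr.
by rewrite big_seq [leRHS]big_seq ler_sum// => u /BE/andP[_ /ltW].
Qed.

Lemma mem_big_jumps (u : R) :
  (u \in fset_set big_jumps) = (0 < u <= T) && (delta < jump f u).
Proof.
rewrite in_fset_set; last exact: finite_big_jumps.
apply/idP/andP => [/set_mem[]|[? ?]]; first by rewrite /= in_itv.
by apply/mem_set; split; rewrite //= in_itv.
Qed.

Local Notation g := (shortened f delta).
Let excess (s t : R) :=
  \sum_(u <- fset_set big_jumps | s < u <= t) (jump f u - delta).

(** One finite index set serves all times up to [T], so that increments of [g] become differences of
    finite sums. *)
Lemma shortenedE (s : R) : 0 <= s -> s <= T ->
  g s = f s - \sum_(u <- fset_set big_jumps | u <= s) (jump f u - delta).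
Proof.
move=> s0 sT; rewrite /shortened; congr (_ - _).
have itvE u : `]0, s]%classic u = (0 < u <= s) :> Prop by rewrite /= in_itv.
rewrite (fsbigE [seq u <- fset_set big_jumps | u <= s]); first last.
- move=> u; rewrite itvE mem_filter mem_big_jumps => /andP[u0 us].
  rewrite u0 us (le_trans us sT)/= -leNgt -subr_le0 => ?.
  exact/max_l.
- move=> u; rewrite itvE /mkset mem_filter mem_big_jumps.
  by move=> /and3P[-> /andP[->]].
- by rewrite filter_uniq// fset_uniq.
rewrite big_filter_cond big_seq_cond [RHS]big_seq_cond; apply: eq_big => u.
  rewrite mem_big_jumps -!andbA; apply: andb_id2l => u0.
  do 2![apply: andb_id2l => _]; apply: andb_idr => us.
  by apply/mem_set; rewrite itvE u0 us.
rewrite mem_big_jumps => /andP[/andP[_ dj] _].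
by rewrite max_r// subr_ge0 ltW.
Qed.

Lemma shortened_diff (s t : R) : 0 <= s -> s <= t -> t <= T ->
  g t - g s = (f t - f s) - excess s t.
Proof.
move=> s0 st tT; rewrite !shortenedE ?(le_trans st)// ?(le_trans s0)//.
suff -> : \sum_(u <- fset_set big_jumps | u <= t) (jump f u - delta) =
  \sum_(u <- fset_set big_jumps | u <= s) (jump f u - delta) + excess s t by lra.
rewrite (bigID (fun u => u <= s))/=; congr (_ + _); apply: eq_bigl => u.
  by rewrite andb_idl// => /le_trans; apply.
by rewrite -ltNge andbC.
Qed.

Lemma excess_ge0 (s t : R) : 0 <= excess s t.
Proof.
rewrite /excess big_seq_cond sumr_ge0// => u.
by rewrite mem_big_jumps subr_ge0 => /andP[/andP[_ /ltW]].
Qed.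

(** Without big jumps the excess vanishes. Otherwise one [delta] is kept from the first big jump,
    those of the others are dropped, and the jumps sum to at most [f t - f s]. *)
Lemma excess_le (s t : R) : 0 <= s -> s <= t ->
  excess s t <= Num.max 0 (f t - f s - delta).
Proof.
move=> s0 st; rewrite /excess -big_filter.
set r := [seq u <- _ | _].
have := @sum_jump_le s t r s0 st (filter_uniq _ (fset_uniq _)).
move=> /(_ _)/wrap[u|]; first by rewrite mem_filter => /andP[].
case: r => [_|x r]; first by rewrite big_nil le_max lexx.
rewrite !big_cons => jle; rewrite le_max; apply/orP; right.
suff : \sum_(u <- r) (jump f u - delta) <= \sum_(u <- r) jump f u by lra.
by apply: ler_sum => u _; rewrite gerBl ltW.
Qed.

Lemma shortened_diff_le (s t : R) : 0 <= s -> s <= t -> t <= T ->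
  g t - g s <= f t - f s.
Proof. by move=> *; rewrite shortened_diff// gerBl excess_ge0. Qed.

Lemma shortened_diff_ge (s t : R) : 0 <= s -> s <= t -> t <= T ->
  Num.min (f t - f s) delta <= g t - g s.
Proof.
move=> s0 st tT; rewrite shortened_diff// ge_min.
have := excess_le _ _ s0 st; rewrite le_max => /orP[?|?].
  by apply/orP; left; lra.
by apply/orP; right; lra.
Qed.

(** Keeping only the excess of the jump at [t] itself suffices to see that [g] jumps by at most
    [delta] there. *)
Lemma shortened_diff_jump (s t : R) : 0 <= s -> s < t -> t <= T ->
  g t - g s <= f t - f s - (jump f t - delta).
Proof.
move=> s0 st tT; have [dj|jd] := ltP delta (jump f t); last first.
  by have := shortened_diff_le _ _ s0 (ltW st) tT; lra.
rewrite (shortened_diff _ _ s0 (ltW st) tT) lerD2l lerN2 /excess.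
rewrite (big_rem t)/=; last by rewrite mem_big_jumps dj (le_lt_trans s0 st) tT.
rewrite st lexx/= lerDl big_seq_cond sumr_ge0// => u /andP[/mem_rem].
by rewrite mem_big_jumps subr_ge0 => /andP[_ /ltW].
Qed.

Lemma shortened_nd (s t : R) : 0 <= s -> s <= t -> t <= T -> g s <= g t.
Proof.
move=> s0 st tT; rewrite -subr_ge0.
apply: le_trans (shortened_diff_ge _ _ s0 st tT).
by rewrite le_min subr_ge0 f_nd//= ltW.
Qed.

Lemma shortened0 : g 0 = f 0.
Proof.
rewrite shortenedE// big_seq_cond big_pred0 ?subr0// => u.
rewrite mem_big_jumps; apply/negP => /andP[/andP[/andP[u0 _] _]].
by rewrite leNgt u0.
Qed.

(** * Upper bound on the covering number *)

Lemma path_range_covered :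
  Defs.covered_by (path_range f T) delta (Num.truncn ((g T - g 0) / delta)).+1.
Proof.
set n := Num.truncn _.
pose E (k : nat) :=
  f @` [set s | 0 <= s <= T /\ k%:R <= (g s - g 0) / delta < k.+1%:R].
have EP k x y : E k x -> E k y -> y - x <= delta.
  move=> [s [/andP[s0 sT] /andP[ks sk]] <-] [t [/andP[t0 tT] /andP[kt tk]] <-].
  have [ts|/ltW st] := leP t s.
    by apply: (@le_trans _ _ 0); [rewrite subr_le0 f_nd|exact: ltW].
  (* Two times in one window satisfy [g t - g s < delta], so the minimum cannot be [delta] and must
     be the increment of [f]. *)
  have := shortened_diff_ge _ _ s0 st tT; rewrite ge_min => /orP[fg|dg].
    apply: (le_trans fg).
    move: ks tk; rewrite ler_pdivlMr// ltr_pdivrMr// -natr1; lra.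
  move: ks tk; rewrite ler_pdivlMr// ltr_pdivrMr// -natr1 mulrDl; lra.
(* For an empty [E k] the value of [inf] is irrelevant: any interval of length [delta] will do. *)
exists (fun k => `[inf (E k), inf (E k) + delta]); split.
  move=> k; rewrite lebesgue_measure_itv/= lte_fin ifT ?ltrDl//.
  by rewrite -EFinB addrAC subrr add0r.
move=> x [s]; rewrite /= in_itv/= => /andP[s0 sT] <-.
have r0 : 0 <= (g s - g 0) / delta.
  by rewrite divr_ge0 ?subr_ge0 ?shortened_nd// ltW.
have kn : (Num.truncn ((g s - g 0) / delta) < n.+1)%N.
  by rewrite ltnS le_truncn// ler_pM2r ?invr_gt0// lerB// shortened_nd.
exists (Ordinal kn) => //=; rewrite in_itv/=.
have Es : E (Num.truncn ((g s - g 0) / delta)) (f s).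
  by exists s => //; split; [rewrite s0|exact: truncn_itv].
apply/andP; split.
  apply: ge_inf => //; exists (f 0) => _ [u [/andP[u0 _] _] <-].
  exact: f_nd.
rewrite -lerBlDr; apply: lb_le_inf; first by exists (f s).
by move=> y Ey; rewrite lerBlDr -lerBlDl; exact: EP Ey Es.
Qed.

(** * Lower bound on the covering number *)

Section right_continuous.
Hypothesis f_rc : forall s : R, 0 <= s -> f u @[u --> s^'+] --> f s.

(** Let z be the supremum of the times at which [g] is at most [y]. If [g] at z is at most [y],
    right continuity bounds the overshoot just after z by [delta]. Otherwise take a time just before
    z: the shortened jump at z and the approximation of the left limit cost [delta] each. *)
Lemma shortened_dense (y : R) : g 0 <= y -> y <= g T ->
  exists s, [/\ 0 <= s, s <= T, g s <= y & y <= g s + 2 * delta].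
Proof.
have d0 := delta0; move=> y0 yT; pose S := [set s : R | 0 <= s <= T /\ g s <= y].
have S0 : S 0 by split; rewrite ?lexx.
have ubS : has_ubound S by exists T => s [/andP[]].
have supS : has_sup S by split => //; exists 0.
have z0 : 0 <= sup S by apply: ub_le_sup.
have zT : sup S <= T by apply: ge_sup => [|s [/andP[]]//]; exists 0.
have [gz|gz] := leP (g (sup S)) y.
- exists (sup S); split => //.
  have [->|zneT] := eqVneq (sup S) T; first by lra.
  have {}zT : sup S < T by rewrite lt_neqAle zneT.
  have /cvgrPdist_le/(_ _ delta0) fz := f_rc _ z0.
  near (sup S)^'+ => v.
  have zv : sup S < v by near: v; exact: nbhs_right_gt.
  have vT : v <= T by near: v; exact: nbhs_right_ltW.
  have := shortened_diff_le _ _ z0 (ltW zv) vT.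
  have : `|f (sup S) - f v| <= delta by near: v.
  rewrite distrC => /(le_trans (ler_norm _)).
  have : y < g v; last by lra.
  rewrite ltNge; apply/negP => gvy.
  suff : v <= sup S by rewrite leNgt zv.
  by apply: ub_le_sup => //; split; rewrite // vT (le_trans z0 (ltW zv)).
- have {}z0 : 0 < sup S.
    by rewrite lt_neqAle z0 andbT; apply: contraTneq gz => <-; rewrite -leNgt.
  have [u [u0 uz fu]] := jump_approx _ _ _ (lexx 0) z0 delta0.
  have := shortened_diff_jump _ _ (ltW u0) uz zT.
  have [s [/andP[s0 sT] gs] /ltW us] := sup_gt (ex_intro _ 0 S0) uz.
  have gu := shortened_nd _ _ (ltW u0) us sT.
  exists u; split; rewrite ?(ltW u0) ?(le_trans (ltW uz))//; lra.
Unshelve. all: by end_near. Qed.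

Lemma shortened_diff_covered (n : nat) :
  Defs.covered_by (path_range f T) delta n -> g T - g 0 <= 4 * delta * n%:R.
Proof.
move=> [I [mI cI]].
(* The centre [c] is the value of [g] at some time that [f] maps into the interval of index [k], or
   0 if there is none. *)
have c_ex (k : nat) : exists c, forall i : 'I_n, i = k :> nat ->
    forall s, 0 <= s <= T -> [set` I i] (f s) -> `|g s - c| <= delta.
  have [kn|nk] := ltnP k n; last first.
    by exists 0 => i ik; move: (ltn_ord i); rewrite ik ltnNge nk.
  have [[s0 s0T Is0]|noS] :=
      pselect (exists2 s, 0 <= s <= T & [set` I (Ordinal kn)] (f s)); last first.
    exists 0 => i ik s sT Is; exfalso; apply: noS; exists s => //.
    by rewrite (_ : Ordinal kn = i)//; apply: val_inj.
  exists (g s0) => i ik s sT Is.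
  have {ik} Ei : Ordinal kn = i by apply: val_inj.
  move: Is0; rewrite Ei => Is0.
  have [/andP[s00 s0T'] /andP[sge0 sT']] := (s0T, sT).
  have fd u v : [set` I i] (f u) -> [set` I i] (f v) -> f v - f u <= delta.
    exact: itv_diam_le.
  have [ss|/ltW ss] := leP s0 s.
    rewrite ger0_norm ?subr_ge0 ?shortened_nd//.
    exact: (le_trans (shortened_diff_le _ _ s00 ss sT') (fd _ _ Is0 Is)).
  rewrite ler0_norm ?subr_le0 ?shortened_nd// opprB.
  exact: (le_trans (shortened_diff_le _ _ sge0 ss s0T') (fd _ _ Is Is0)).
have {c_ex} [c cP] := choice c_ex.
(* If [g s] is within [delta] of [c k], then [[g s, g s + 2 * delta]] lies in [J k]. *)
pose J k := `[c k - delta, c k + 3 * delta]%classic.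
have JP k : lebesgue_measure (J k) = (4 * delta)%:E.
  rewrite lebesgue_measure_itv/= lte_fin ifT; last by have := delta0; lra.
  by rewrite -EFinB; congr EFin; lra.
have g0T : g 0 <= g T by exact: shortened_nd.
have : (lebesgue_measure `[g 0, g T]%classic
    <= \sum_(k < n) lebesgue_measure (J k))%E.
  apply: content_subadditive; [by move=> *; exact: measurable_itv|
                               exact: measurable_itv|].
  move=> y /=; rewrite in_itv/= => /andP[y0 yT].
  have [s [s0 sT gs sg]] := shortened_dense y y0 yT.
  have /cI [i _ Ii] : path_range f T (f s).
    by exists s => //=; rewrite in_itv/= s0.
  rewrite -bigcup_mkord; exists i; first exact: ltn_ord.
  have := cP i i erefl s _ Ii; rewrite s0 sT => /(_ isT).
  by rewrite /J/= in_itv/= ler_norml; lra.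
under eq_bigr do rewrite JP.
rewrite sumEFin sumr_const card_ord lebesgue_measure_itv/= lte_fin mulr_natr.
case: ltP => [_|gT0 _]; first by rewrite -EFinB lee_fin.
by rewrite (@le_trans _ _ 0) ?subr_le0// mulrn_wge0// mulr_ge0// ltW.
Qed.

(** * Comparison of N and L *)

Hypothesis f0 : f 0 = 0.

Lemma boxL_le_boxN : boxL f T delta <= 4 * boxN f T delta.
Proof.
have [/shortened_diff_covered + _] := covering_numberP _ _ _ _ path_range_covered.
by rewrite shortened0 f0 subr0 /boxL ler_pdivrMl// mulrCA mulrA.
Qed.

Lemma boxN_le_boxL : boxN f T delta <= boxL f T delta + 1.
Proof.
have [_] := covering_numberP _ _ _ _ path_range_covered.
rewrite /boxN -(ler_nat R) => /le_trans; apply; rewrite -natr1 lerD2r.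
have gT : 0 <= g T by rewrite -f0 -shortened0 shortened_nd.
rewrite shortened0 f0 subr0 /boxL mulrC truncn_le.
by rewrite mulr_ge0// invr_ge0 ltW.
Qed.

Lemma boxL_ge1 : delta < f T -> 1 <= boxL f T delta.
Proof.
move=> dfT; rewrite /boxL ler_pdivlMl// mulr1.
have := shortened_diff_ge _ _ (lexx 0) T0 (lexx T).
by rewrite shortened0 f0 !subr0 min_r// ltW.
Qed.

Lemma boxL_eq0 : f T = 0 -> boxL f T delta = 0.
Proof.
move=> fT; rewrite /boxL (_ : g T = 0) ?mulr0//; apply/eqP; rewrite eq_le.
have := shortened_diff_le _ _ (lexx 0) T0 (lexx T).
have := shortened_nd _ _ (lexx 0) T0 (lexx T).
by rewrite shortened0 f0 fT !subr0 => -> ->.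
Qed.

Lemma ln_boxN_boxL : f T = 0 \/ delta < f T ->
  `|ln (boxN f T delta) - ln (boxL f T delta)| <= ln 4.
Proof.
have [N L1] := (boxN_le_boxL, boxL_le_boxN).
have ln4 : 0 <= ln 4 :> R by rewrite ln_ge0// ler1n.
move=> [fT|dfT].
  rewrite boxL_eq0// (ln0 (lexx 0)) subr0.
  suff -> : ln (boxN f T delta) = 0 by rewrite normr0.
  move: N; rewrite boxL_eq0// add0r /boxN lern1.
  (* N is at most 1, and [ln] vanishes at both 0 and 1. *)
  by case: covering_number => [|[|]]// _; [rewrite mulr0n ln0|rewrite ln1].
have L0 := boxL_ge1 dfT.
have N0 : 0 < boxN f T delta by lra.
have lnD (x y : R) : 0 < x -> 0 < y -> x <= 4 * y -> ln x - ln y <= ln 4.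
  move=> x0 y0 xy; rewrite lerBlDr -lnM ?posrE// ler_ln ?posrE//.
  by rewrite mulr_gt0.
(* As L is at least 1, [L + 1 <= 4 * L], so [ln 4] serves for both directions. *)
by rewrite ler_norml lerNl opprB !lnD//; lra.
Qed.

End right_continuous.
End truncation.
End nondecreasing_path.

(** A bounded difference of logarithms is negligible against [ln (1 / d)], which tends to
    infinity. *)
Lemma cvg_ln_ratio (R : realType) (u v : R -> R) (C l : R) :
  (\forall d \near 0^'+, `|ln (u d) - ln (v d)| <= C) ->
  ln (u d) / ln (1 / d) @[d --> 0^'+] --> l ->
  ln (v d) / ln (1 / d) @[d --> 0^'+] --> l.
Proof.
move=> uvC ul.
have diff0 : (ln (v d) - ln (u d)) / ln (1 / d) @[d --> 0^'+] --> (0 : R).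
  apply/cvgrPdist_le => e e0; near=> d.
  have d0 : 0 < d by near: d; exact: nbhs_right_gt.
  (* The 1 makes [ln (1 / d)] positive, [C / e] makes the quotient at most [e]. *)
  have ed : Num.max 1 (C / e) <= ln (1 / d).
    rewrite div1r lnV// lerNr -ler_expR lnK//; apply: ltW.
    by near: d; apply: nbhs_right_lt; exact: expR_gt0.
  move: ed; rewrite ge_max => /andP[l1 Cl].
  have l0 : 0 < ln (1 / d) by lra.
  rewrite sub0r normrN normrM normfV (gtr0_norm l0) ler_pdivrMr// distrC.
  apply: (@le_trans _ _ C); first by near: d.
  by move: Cl; rewrite ler_pdivrMr// mulrC.
have vE d : ln (v d) / ln (1 / d) =
    ln (u d) / ln (1 / d) + (ln (v d) - ln (u d)) / ln (1 / d).
  by rewrite -mulrDl addrC subrK.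
under eq_fun do rewrite vE.
by rewrite -[l]addr0; exact: cvgD.
Unshelve. all: by end_near. Qed.

(* The constants are uniform in the subordinator, the path, t and delta. The
   lower bound on L needs delta < X_t: if X_t <= delta then N = 1, whereas
   L = X_t / delta can be arbitrarily small. In the limits, ln 0 = 0 matters
   only when X_t = 0, where N = 1 and L = 0 for all delta. *)
Theorem theorem2p7 (R : realType) :
  (exists A B : R, [/\ 0 < A, 0 < B &
    forall (d : measure_display) (T : measurableType d) (P : probability T R)
      (X : R -> {RV P >-> R}), subordinator X ->
    {ae P, forall w (t delta : R), 0 < t -> 0 < delta ->
      let N := boxN (fun s => X s w) t delta in
      let L := boxL (fun s => X s w) t delta in
      L <= B * N /\ (delta < X t w -> A * N <= L)}]) /\
  (forall (d : measure_display) (T : measurableType d) (P : probability T R)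
     (X : R -> {RV P >-> R}), subordinator X ->
   {ae P, forall w (t : R), 0 < t -> forall l : R,
     ln (boxN (fun s => X s w) t delta) / ln (1 / delta)
       @[delta --> 0^'+] --> l <->
     ln (boxL (fun s => X s w) t delta) / ln (1 / delta)
       @[delta --> 0^'+] --> l}).
Proof.
split.
  (* The factor 1/2 comes from [N <= L + 1 <= 2 * L] when L is at least 1. *)
  exists 2^-1, 4; split=> [||d T P X [X0 Xnd Xrc _ _]].
  - by rewrite invr_gt0.
  - by [].
  - move: X0 Xnd Xrc; apply: filterS3 => w X0 Xnd Xrc t delta /ltW t0 delta0.
    split=> [|dX]; first exact: boxL_le_boxN.
    have := @boxN_le_boxL _ _ Xnd _ _ delta0 t0 X0.
    have := @boxL_ge1 _ _ Xnd _ _ delta0 t0 X0 dX.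
    by lra.
move=> d T P X [X0 Xnd Xrc _ _].
move: X0 Xnd Xrc; apply: filterS3 => w X0 Xnd Xrc t /ltW t0 l.
set N := boxN _ t; set L := boxL _ t.
have Xt0 : X t w = 0 \/ 0 < X t w.
  by have := Xnd 0 t (lexx 0) t0; rewrite X0 le_eqVlt => /predU1P[->|]; auto.
have NL : \forall e \near 0^'+, `|ln (N e) - ln (L e)| <= ln 4.
  (* If [X t w] is positive, [e < X t w] holds for all small [e]. *)
  case: Xt0 => Xt0; near=> e; apply: ln_boxN_boxL => //; [by left|right].
  by near: e; exact: nbhs_right_lt.
split; apply: (@cvg_ln_ratio _ _ _ (ln 4)); first exact: NL.
by apply: filterS NL => e; rewrite distrC.
Unshelve. all: by end_near. Qed.
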